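(* If $H=(V,\Delta)$ is a Steiner triple system on $|V|=n$ vertices, then $H$ has $\Omega\big((n/6)^{n/12}\big)$ spanning trees (as $n\to\infty$).
   Context: A 3-graph is $H=(V,\Delta)$ with $\Delta\subseteq\binom V3$ (triples). It is a Steiner triple system if every pair of distinct vertices is contained in exactly one triple. A cycle in $H$ is a sequence $a_0,t_1,a_1,\dots,t_\ell,a_\ell=a_0$, $\ell\ge2$, with distinct vertices $a_0,\dots,a_{\ell-1}$, distinct triples, $a_{i-1},a_i\in t_i$. A spanning tree is a set of triples containing no cycle, covering $V$, and connected via paths of triples of $T$. *)

(* Defs.v *)
From HB Require Import structures.
From mathcomp Require Import all_boot all_order all_algebra.
From mathcomp Require Import boolp reals exp.
Set Implicit Arguments.
Unset Strict Implicit.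
Unset Printing Implicit Defensive.

Definition three_graph (V : finType) (D : {set {set V}}) : Prop :=
  forall t : {set V}, t \in D -> #|t| = 3.

Definition steiner_triple_system (V : finType) (D : {set {set V}}) : Prop :=
  three_graph D /\
  forall x y : V, x != y ->
    exists! t : {set V}, t \in D /\ (x \in t /\ y \in t).

(* a_0, t_1, a_1, ..., t_l, a_l = a_0, where [t i] is t_(i+1); the closing
   condition a_l = a_0 comes from [ordS] being the successor modulo l. *)
Definition is_cycle (V : finType) (T : {set {set V}}) (l : nat)
    (a : 'I_l -> V) (t : 'I_l -> {set V}) : Prop :=
  [/\ 2 <= l, injective a, injective t, forall i : 'I_l, t i \in T &
      forall i : 'I_l, a i \in t i /\ a (ordS i) \in t i].

Definition acyclic (V : finType) (T : {set {set V}}) : Prop :=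
  forall (l : nat) (a : 'I_l -> V) (t : 'I_l -> {set V}), ~ is_cycle T a t.

(* a_0, t_1, a_1, ..., t_l, a_l, where [t i] is t_(i+1); l = 0 is allowed. *)
Definition is_path (V : finType) (T : {set {set V}}) (l : nat)
    (a : 'I_l.+1 -> V) (t : 'I_l -> {set V}) : Prop :=
  [/\ injective a, injective t, forall i : 'I_l, t i \in T &
      forall i : 'I_l,
        a (widen_ord (leqnSn l) i) \in t i /\ a (lift ord0 i) \in t i].

Definition connected_by (V : finType) (T : {set {set V}}) : Prop :=
  forall x y : V, exists (l : nat) (a : 'I_l.+1 -> V) (t : 'I_l -> {set V}),
    [/\ is_path T a t, a ord0 = x & a ord_max = y].

Definition spanning_tree (V : finType) (D T : {set {set V}}) : Prop :=
  [/\ T \subset D, acyclic T, cover T = [set: V] & connected_by T].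

Definition spanning_trees (V : finType) (D : {set {set V}})
    : {set {set {set V}}} :=
  [set T : {set {set V}} | `[< spanning_tree D T >]].

(* Main.v *)
(* Fix a root r in a system on n = 2m + 1 points, and grow a tree from r by adding
   triples that meet the current vertex set U in exactly one point. After k steps
   |U| = 2k + 1. Such triples number at least (2k + 1)(m - 2k), since a point of U
   lies in m triples of which at most 2k meet U again. They also number at least
   m - k: the points of U are partitioned by the triples through a point outside U,
   and |U| is odd, so every outside point lies on such a triple. A tree with k + 1
   triples arises from at most k + 1 trees with k triples. Hence the number f_k of
   grown trees satisfies f_(k+1) >= (m - 2k) f_k and
   (k + 1) f_(k+1) >= (m - k) f_k, which give
   (m - 2a)^a <= f_a <= C(m, a) f_m <= 2^m f_m. Take a = m / 4: the exponent
   exceeds n / 12 by about m / 12, which absorbs 2^m for large m. *)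
Require Import Defs.
From HB Require Import structures.
From mathcomp Require Import all_boot all_order all_algebra.
From mathcomp Require Import boolp reals exp.
From mathcomp Require Import zify lra.
Set Implicit Arguments.
Unset Strict Implicit.
Unset Printing Implicit Defensive.
Import Order.TTheory GRing.Theory Num.Theory.

(** * Point counts in a Steiner triple system *)

Section SteinerTripleSystem.
Variables (V : finType) (D : {set {set V}}).
Hypothesis stsD : steiner_triple_system D.

Lemma sts_card t : t \in D -> #|t| = 3.
Proof. by move: stsD => [h _]; exact: h. Qed.

(** Each point of [A] differs from [x], hence shares exactly one triple with it; exchanging the sums
    counts that point once. *)
Lemma sum_card_setI_through x (A : {set V}) : x \notin A ->
  \sum_(t in D | x \in t) #|t :&: A| = #|A|.
Proof.
move=> xA; under eq_bigr do rewrite -sum1_card.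
rewrite (exchange_big_dep (mem A)) /=; last by move=> t y _; rewrite inE => /andP[].
rewrite -sum1_card; apply: eq_bigr => y yA.
have xy : x != y by apply: contraNneq xA => ->.
have [t [[tD [xt yt]] tu]] := stsD.2 _ _ xy.
rewrite (big_pred1 t) // => t'; rewrite inE yA andbT /=.
by apply/idP/eqP => [/andP[/andP[t'D xt'] yt']|->]; [symmetry; exact: tu | rewrite tD xt yt].
Qed.

Definition degree x := #|[set t in D | x \in t]|.

Lemma sts_card_vertices x : #|V| = (degree x).*2.+1.
Proof.
have := @sum_card_setI_through x (~: [set x]).
rewrite !inE eqxx => /(_ isT).
rewrite (eq_bigr (fun=> 2)); last first.
  by move=> t /andP[tD xt]; have := sts_card tD; rewrite -setDE (cardsD1 x) xt => -[].
rewrite sum_nat_const cardsC1 => h.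
have : 0 < #|V| by apply/card_gt0P; exists x.
have : degree x * 2 = #|V|.-1 by rewrite -h /degree cardsE.
lia.
Qed.

(** * Triples meeting a vertex set in one point *)

Definition tangents (U : {set V}) := [set t in D | #|t :&: U| == 1].

Lemma tangents_odd (U : {set V}) : odd #|U| -> #|V| - #|U| <= (#|tangents U|).*2.
Proof.
move=> oddU.
have sub : ~: U \subset \bigcup_(t in tangents U) (t :\: U).
  apply/subsetP => v; rewrite inE => vU.
  suff [t tE vt] : exists2 t, t \in tangents U & v \in t.
    by apply/bigcupP; exists t => //; rewrite inE vU.
  move: oddU; rewrite -(sum_card_setI_through vU).
  case: (boolP [exists t, (t \in tangents U) && (v \in t)]) => [/existsP[t /andP[]]|].
    by exists t.
  (* With no tangent through [v], each triple through [v] meets [U] in 0 or 2 points, as [v] itself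
     lies outside; the sum is then even. *)
  rewrite negb_exists => /forallP nex; rewrite (_ : odd _ = false) //.
  elim/big_ind: _ => //= [a b|t /andP[tD vt]].
    by rewrite oddD => -> ->.
  move: (nex t); rewrite vt andbT inE tD /= => n1.
  have : #|t :&: U| < 3.
    rewrite -(sts_card tD); apply/proper_card/properP; split; first exact: subsetIl.
    by exists v => //; rewrite inE (negPf vU) andbF.
  by case: #|_| n1 => [|[|[|]]].
have := subset_leq_card sub; have := cardsC U => h1 h2.
have h3 : #|\bigcup_(t in tangents U) (t :\: U)| <= \sum_(t in tangents U) #|t :\: U|.
  elim/big_rec2: _ => [|t a B _ h]; first by rewrite cards0.
  by rewrite cardsU; lia.
have h4 : \sum_(t in tangents U) #|t :\: U| = \sum_(t in tangents U) 2.
  apply: eq_bigr => t; rewrite inE => /andP[/sts_card tD /eqP t1].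
  by rewrite cardsD; lia.
by move: h3; rewrite h4 sum_nat_const; lia.
Qed.

Lemma tangents_many (U : {set V}) m : (forall x, degree x = m) ->
  #|U| * (m - #|U|.-1) <= #|tangents U|.
Proof.
move=> degm.
have -> : #|tangents U| = \sum_(t in tangents U) \sum_(u in t :&: U) 1.
  rewrite -sum1_card; apply: eq_bigr => t; rewrite inE sum1_card.
  by move=> /andP[_ /eqP ->].
rewrite (exchange_big_dep (mem U)) /=; last by move=> t y _; rewrite inE => /andP[].
rewrite -sum_nat_const; apply: leq_sum => u uU.
rewrite leq_subLR -(degm u) /degree.
(* The triples through [u] that meet [U] again number at most |U| - 1: the sum is |U| - 1 and each
   of them contributes at least 1. *)
have := @sum_card_setI_through u (U :\ u); rewrite !inE eqxx => /(_ isT) s.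
rewrite (cardsD1 u U) uU /= -s -!sum1_card.
rewrite (eq_bigl (fun t => (t \in D) && (u \in t))); last by move=> t; rewrite inE.
rewrite [X in _ <= _ + X]big_mkcond [X in _ <= X + _]big_mkcond [X in X <= _]big_mkcond /=.
rewrite -big_split /=; apply: leq_sum => t _.
rewrite !inE uU andbT; case: (boolP (t \in D)) => //= tD; case: (boolP (u \in t)) => //= ut.
rewrite andbT; have -> : t :&: (U :\ u) = (t :&: U) :\ u by rewrite setIDA.
have := cardsD1 u (t :&: U); rewrite inE ut uU /= => ->.
by case: #|_|.
Qed.

(** * Growing trees from a root *)

Variable r : V.

(** Adjoining [r] lets the empty set of triples, which covers nothing, start from a single
    vertex. *)
Definition span (T : {set {set V}}) := r |: cover T.

(** Trees are kept as sets of triples, without the order of insertion, so that distinct elements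
    count as distinct trees. *)
Fixpoint grown k : {set {set {set V}}} :=
  if k is k'.+1 then
    [set x.2 |: x.1 | x in [set x : {set {set V}} * {set V} |
       (x.1 \in grown k') && (x.2 \in tangents (span x.1))]]
  else [set set0].

Lemma grownSP k S : reflect
  (exists T t, [/\ T \in grown k, t \in tangents (span T) & S = t |: T])
  (S \in grown k.+1).
Proof.
apply: (iffP imsetP) => [[[T t]]|[T [t [Tk tT ->]]]].
  by rewrite inE /= => /andP[Tk tT] ->; exists T, t.
by exists (T, t) => //; rewrite inE Tk.
Qed.

Lemma spanU1 t T : span (t |: T) = t :|: span T.
Proof. by rewrite /span /cover bigcup_setU big_set1 setUCA. Qed.

Lemma tangent_notin t T : t \in tangents (span T) -> t \notin T.
Proof.
rewrite inE => /andP[tD t1]; apply/negP => tT; move: t1.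
have /setIidPl -> : t \subset span T by rewrite subsetU // (bigcup_max t) ?orbT.
by rewrite (sts_card tD).
Qed.

Lemma grown_sub k T : T \in grown k -> T \subset D.
Proof.
elim: k T => [|k IH] T; first by rewrite inE => /eqP ->; exact: sub0set.
case/grownSP => T' [t [/IH sT]]; rewrite inE => /andP[tD _ ->].
by rewrite subUset sub1set tD.
Qed.

Lemma card_grown k T : T \in grown k -> #|T| = k.
Proof.
elim: k T => [|k IH] T; first by rewrite inE => /eqP ->; rewrite cards0.
by case/grownSP => T' [t [/IH <- /tangent_notin tT ->]]; rewrite cardsU1 tT.
Qed.

Lemma card_span k T : T \in grown k -> #|span T| = k.*2.+1.
Proof.
elim: k T => [|k IH] T.
  by rewrite inE => /eqP ->; rewrite /span /cover big_set0 setU0 cards1.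
case/grownSP => T' [t [/IH sT]]; rewrite inE => /andP[tD /eqP t1] ->.
by rewrite spanU1 cardsU t1 sT (sts_card tD).
Qed.

(** Double counting of growth steps: adding [t] and remembering it is injective, since [t] is new,
    and each result has k + 1 triples that could be the remembered one. *)
Lemma grown_count k c :
  (forall T, T \in grown k -> c <= #|tangents (span T)|) ->
  #|grown k| * c <= #|grown k.+1| * k.+1.
Proof.
move=> hc.
pose P := [set x : {set {set V}} * {set V} |
  (x.1 \in grown k) && (x.2 \in tangents (span x.1))].
pose Q := [set x : {set {set V}} * {set V} | (x.1 \in grown k.+1) && (x.2 \in x.1)].
have cP : #|P| = \sum_(T in grown k) #|tangents (span T)|.
  rewrite -sum1_card; under [RHS]eq_bigr do rewrite -sum1_card.
  by rewrite pair_big_dep /=; apply: eq_bigl => x; rewrite inE.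
have cQ : #|Q| = #|grown k.+1| * k.+1.
  rewrite -sum_nat_const -sum1_card.
  rewrite (eq_bigr (fun T : {set {set V}} => \sum_(t in T) 1)); last first.
    by move=> T /card_grown <-; rewrite sum1_card.
  by rewrite pair_big_dep /=; apply: eq_bigl => x; rewrite inE.
apply: (@leq_trans #|P|); first by rewrite cP -sum_nat_const; apply: leq_sum.
rewrite -cQ.
pose g (x : {set {set V}} * {set V}) := (x.2 |: x.1, x.2).
have injg : {in P &, injective g}.
  move=> [T t] [T' t']; rewrite !inE /= => /andP[_ h] /andP[_ h'] [eT et].
  rewrite -{}et in h' eT *; congr pair.
  have nt : t \notin T by apply: tangent_notin; rewrite inE.
  have nt' : t \notin T' by apply: tangent_notin; rewrite inE.
  by rewrite -(setU1K nt) eT setU1K.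
rewrite -(card_in_imset injg); apply: subset_leq_card; apply/subsetP => _ /imsetP[[T t] xP ->].
rewrite inE /= setU11 andbT; apply/grownSP; exists T, t.
by move: xP; rewrite inE /= => /andP[].
Qed.

Lemma grown_mul_lb k : #|grown k| * (degree r - k) <= #|grown k.+1| * k.+1.
Proof.
apply: grown_count => T Tk.
have cU := card_span Tk; have := @tangents_odd (span T).
by rewrite cU /= odd_double (sts_card_vertices r) => /(_ isT); lia.
Qed.

(** The factor 2k + 1 from [tangents_many] outweighs the division by k + 1. *)
Lemma grown_fast k : #|grown k| * (degree r - k.*2) <= #|grown k.+1|.
Proof.
have := @grown_count k (k.*2.+1 * (degree r - k.*2)) => h.
rewrite -(@leq_pmul2r k.+1) //; apply: leq_trans (h _); last first.
  move=> T Tk; rewrite -[k.*2]/(k.*2.+1.-1) -(card_span Tk); apply: tangents_many.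
  by move=> x; have := sts_card_vertices x; rewrite (sts_card_vertices r); lia.
by rewrite mulnAC -mulnA leq_mul2l leq_mul2r; apply/orP; right; apply/orP; right; lia.
Qed.

Lemma grown_pow_lb a : (degree r - a.*2) ^ a <= #|grown a|.
Proof.
(* The base stays fixed at its smallest value while the exponent runs up to [a]. *)
suff: forall k, k <= a -> (degree r - a.*2) ^ k <= #|grown k| by exact.
elim=> [_|k IH ka]; first by rewrite cards1.
apply: leq_trans (grown_fast k); rewrite expnSr; apply: leq_mul; first by apply: IH; lia.
by rewrite leq_sub2l // leq_double ltnW.
Qed.

(** The ratio of |grown k| to C(m, k) does not decrease with k up to m, and C(m, m) = 1. *)
Lemma grown_top a : a <= degree r -> #|grown a| <= #|grown (degree r)| * 2 ^ degree r.
Proof.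
set m := degree r => am.
have step k : k < m -> #|grown k| * 'C(m, k.+1) <= #|grown k.+1| * 'C(m, k).
  move=> km; rewrite -(@leq_pmul2r k.+1) // -mulnA [_ * k.+1 in X in X <= _]mulnC.
  rewrite mul_bin_left mulnAC mulnA.
  by rewrite leq_mul2r grown_mul_lb orbT.
have up j : a + j <= m -> #|grown a| * 'C(m, a + j) <= #|grown (a + j)| * 'C(m, a).
  elim: j => [|j IH]; first by rewrite addn0.
  rewrite addnS => h; have := IH (ltnW h) => {}IH; have := step _ h => st.
  have pos : 0 < 'C(m, a + j) by rewrite bin_gt0 ltnW.
  rewrite -(leq_pmul2r pos).
  apply: (@leq_trans (#|grown (a + j)| * 'C(m, a) * 'C(m, (a + j).+1))).
    by rewrite mulnAC leq_mul2r IH orbT.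
  by rewrite mulnAC [leqRHS]mulnAC leq_mul2r st orbT.
have := up (m - a); rewrite subnKC // leqnn binn muln1 => /(_ isT) h.
apply: (leq_trans h); rewrite leq_mul2l; apply/orP; right.
(* C(m, a) is one term of the expansion of (1 + 1)^m. *)
rewrite -[2]/(1 + 1) expnDn (bigD1 (Ordinal (am : a < m.+1))) //= !exp1n !muln1.
exact: leq_addr.
Qed.

(** * Grown sets are spanning trees *)

(* The two vertices of a cycle on the last added triple also lie on earlier triples
   of the cycle, but that triple meets the earlier span in a single point. *)
Lemma grown_acyclic k T : T \in grown k -> acyclic T.
Proof.
elim: k T => [|k IH] T.
  rewrite inE => /eqP -> l a t [l2 _ _ /(_ (Ordinal (ltnW l2)))].
  by rewrite inE.
case/grownSP => T' [t0 [/IH acT]]; rewrite inE => /andP[_ /cards1P[w tw]] -> l a t.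
case=> l2 inja injt tT at_.
have sub i : t i != t0 -> t i \in T' by move=> ne; have := tT i; rewrite !inE (negPf ne).
have [/existsP[i /eqP ti]|] := boolP [exists i, t i == t0]; last first.
  rewrite negb_exists => /forallP h; apply: (acT l a t); split => // i.
  exact: sub.
have ordSne (j : 'I_l) : ordS j != j.
  have jl := ltn_ord j; apply/eqP => /(congr1 val) /=.
  by have [e|jl'] := eqVneq j.+1 l; [rewrite e modnn|rewrite modn_small]; lia.
have old j v : j != i -> v \in t j -> v \in span T'.
  move=> ji vt; rewrite inE; apply/orP; right; apply/bigcupP; exists (t j) => //.
  by apply: sub; rewrite -ti; apply: contra ji => /eqP /injt ->.
have [ati aSti] := at_ i.
have ai : a i \in span T'.
  apply: (old (ord_pred i)); first by rewrite -[i in X in _ != X]ord_predK eq_sym ordSne.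
  by have [_] := at_ (ord_pred i); rewrite ord_predK.
have aSi : a (ordS i) \in span T'.
  by apply: (old (ordS i)); [exact: ordSne | exact: (at_ _).1].
have e1 : a i \in [set w] by rewrite -tw inE -ti ati.
have e2 : a (ordS i) \in [set w] by rewrite -tw inE -ti aSti.
move: e1 e2; rewrite !inE => /eqP e1 /eqP e2.
by have := ordSne i; rewrite (inja _ _ (etrans e2 (esym e1))) eqxx.
Qed.

(* The span condition keeps the vertices distinct when a path, even one of length 0,
   is extended by a point outside the span. *)
Definition joined (T : {set {set V}}) (x y : V) := exists l (a : nat -> V) t,
  [/\ [/\ a 0 = x, a l = y & {in [pred i | i <= l], forall i, a i \in span T}],
      {in [pred i | i <= l] &, injective a}, {in [pred i | i < l] &, injective t} &
      forall i, i < l -> [/\ t i \in T, a i \in t i & a i.+1 \in t i]].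

Lemma joined_sym T x y : joined T x y -> joined T y x.
Proof.
move=> [l [a [t [[a0 al aU] inja injt at_]]]].
exists l, (fun i => a (l - i)), (fun i => t (l.-1 - i)); split.
- by split; rewrite ?subn0 ?subnn // => i _; apply: aU; rewrite inE leq_subr.
- by move=> i j; rewrite !inE => il jl /inja; rewrite !inE; lia.
- by move=> i j; rewrite !inE => il jl /injt; rewrite !inE; lia.
- move=> i il; have [|h1 h2 h3] := at_ (l.-1 - i); first lia.
  have e1 : (l.-1 - i).+1 = l - i by lia.
  have e2 : l.-1 - i = l - i.+1 by lia.
  by rewrite -e1 -e2.
Qed.

Lemma joined_refl T x : x \in span T -> joined T x x.
Proof.
move=> xT; exists 0, (fun=> x), (fun=> set0); split=> //; first by split.
by move=> i j; rewrite !inE !leqn0 => /eqP -> /eqP ->.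
Qed.

Lemma joined_is_path T x y : joined T x y ->
  exists l (a : 'I_l.+1 -> V) (t : 'I_l -> {set V}),
    [/\ is_path T a t, a ord0 = x & a ord_max = y].
Proof.
move=> [l [a [t [[a0 al aU] inja injt at_]]]].
exists l, (fun i => a i), (fun i => t i); split=> //; split.
- by move=> i j /inja e; apply/val_inj/e; rewrite inE -ltnS ltn_ord.
- by move=> i j /injt e; apply/val_inj/e; rewrite inE ltn_ord.
- by move=> i; have [] := at_ i (ltn_ord i).
- by move=> i; have [] := at_ i (ltn_ord i).
Qed.

Lemma joined_snoc (T : {set {set V}}) t x u y :
  t \notin T -> joined T x u -> u \in t -> y \in t -> y \notin span T -> joined (t |: T) x y.
Proof.
move=> tT [l [a [s [[a0 al aU] inja injt at_]]]] ut yt yT.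
have sT i : i < l -> s i != t by move=> /at_[h _ _]; apply: contraNneq tT => <-.
exists l.+1, (fun i => if i <= l then a i else y), (fun i => if i < l then s i else t).
split.
- split; rewrite ?ltnn // => i; rewrite spanU1 inE => il.
  by case: ifP => il'; rewrite inE ?yt // aU ?orbT.
- move=> i j; rewrite !inE => il jl.
  case: ifP => il'; case: ifP => jl' e; [exact: inja | | | lia].
    by case/negP: yT; rewrite -e; exact: aU.
  by case/negP: yT; rewrite e; exact: aU.
- move=> i j; rewrite !inE => il jl.
  case: ifP => il'; case: ifP => jl' e; [exact: injt | | | lia].
    by case/eqP: (sT _ il').
  by case/eqP: (sT _ jl').
- move=> i; rewrite ltnS leq_eqVlt => /orP[/eqP ->|il].
    by rewrite ltnn eqxx /= al setU11.
  by have [h1 h2 h3] := at_ _ il; rewrite il orbT inE h1 orbT.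
Qed.

Lemma joinedU1 t T x y : joined T x y -> joined (t |: T) x y.
Proof.
move=> [l [a [s [[a0 al aU] inja injt at_]]]]; exists l, a, s; split=> //.
  by split=> // i /aU; rewrite spanU1 !inE => ->; rewrite orbT.
by move=> i /at_[h1 h2 h3]; rewrite inE h1 orbT.
Qed.

Lemma grown_joined k T : T \in grown k -> {in span T &, forall x y, joined T x y}.
Proof.
elim: k T => [|k IH] T.
  rewrite inE => /eqP -> x y; rewrite /span /cover big_set0 setU0 !inE => /eqP -> /eqP ->.
  by apply: joined_refl; rewrite inE set11.
case/grownSP => T' [t [/IH jT tT]] ->.
have tT' := tangent_notin tT; move: tT; rewrite inE => /andP[_ /cards1P[w tw]].
have : w \in t :&: span T' by rewrite tw set11.
rewrite inE => /andP[wt wT].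
have on x y : x \in span T' -> y \in t -> y \notin span T' -> joined (t |: T') x y.
  by move=> xT yt yT; apply: (joined_snoc tT' (jT _ _ xT wT) wt).
move=> x y; rewrite spanU1 => xU yU.
have [->|xy] := eqVneq x y; first by apply: joined_refl; rewrite spanU1.
(* Old vertices are joined by induction, an old and a new one through [w], where [t] meets the old
   span, and two new ones by [t] alone. *)
have [xT|xT] := boolP (x \in span T'); have [yT|yT] := boolP (y \in span T').
- exact/joinedU1/jT.
- by apply: on => //; move: yU; rewrite inE (negPf yT) orbF.
- by apply/joined_sym/on => //; move: xU; rewrite inE (negPf xT) orbF.
- move: xU yU; rewrite !(inE, negPf xT, negPf yT) !orbF => xt yt.
  exists 1, (fun i => if i == 0 then x else y), (fun=> t); split.
  + by split=> // i _; rewrite spanU1; case: ifP; rewrite inE ?xt ?yt.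
  + move=> i j; rewrite !inE; case: i j => [|[|]] // [|[|]] //= _ _ /eqP.
      by rewrite (negPf xy).
    by rewrite eq_sym (negPf xy).
  + by move=> [|i] [|j]; rewrite !inE.
  + by move=> [|i] //= _; rewrite setU11.
Qed.

(** [span] contains [r] by definition, but a spanning tree must cover it by a triple; the first
    triple added does, being tangent to the singleton of [r]. *)
Lemma root_in_cover k T : T \in grown k.+1 -> r \in cover T.
Proof.
elim: k T => [|k IH] T /grownSP[T' [t [T'k tT ->]]].
  move: T'k tT; rewrite !inE => /eqP ->; rewrite /span /cover big_set0 setU0 => /andP[_].
  move=> /cards1P[w tw]; have : w \in t :&: [set r] by rewrite tw set11.
  by rewrite !inE => /andP[wt /eqP <-]; apply/bigcupP; exists t; rewrite ?setU11.
have /bigcupP[s sT rs] := IH _ T'k.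
by apply/bigcupP; exists s => //; rewrite inE sT orbT.
Qed.

Lemma grown_spanning : 0 < degree r -> grown (degree r) \subset spanning_trees D.
Proof.
move=> d0; apply/subsetP => T Tm; rewrite inE; apply/asboolP.
(* After m steps the span has 2m + 1 points, which is all of them. *)
have sT : span T = [set: V].
  by apply/eqP; rewrite eqEcard subsetT cardsT (card_span Tm) (sts_card_vertices r) leqnn.
split.
- exact: grown_sub Tm.
- exact: grown_acyclic Tm.
- rewrite -sT; apply/esym/setUidPr; rewrite sub1set.
  by move: Tm; rewrite -(prednK d0) => /root_in_cover.
- by move=> x y; apply/joined_is_path/(grown_joined Tm); rewrite sT.
Qed.

Lemma spanning_trees_lb a : 0 < degree r -> a <= degree r ->
  (degree r - a.*2) ^ a <= #|spanning_trees D| * 2 ^ degree r.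
Proof.
move=> d0 am; apply: leq_trans (grown_pow_lb a) _.
apply: leq_trans (grown_top am) _; rewrite leq_mul2r.
by rewrite (subset_leq_card (grown_spanning d0)) orbT.
Qed.

End SteinerTripleSystem.

(** * The asymptotic estimate *)

Local Open Scope ring_scope.

Lemma powR_le_of_expn_le (R : realType) (m f : nat) : (2 ^+ 25 <= m%:R :> R) ->
  ((m - (m %/ 4).*2) ^ (m %/ 4) <= f * 2 ^ m)%N ->
  powR (m.*2.+1%:R / 6%:R) (m.*2.+1%:R / 12%:R) <= f%:R :> R.
Proof.
set a := (m %/ 4)%N => m_big h.
have m32 : 32 <= m%:R :> R by apply: le_trans m_big; rewrite (_ : 32 = 2 ^+ 5) ?ler_eXn2l //; lra.
have eN : m.*2.+1%:R = 2 * m%:R + 1 :> R by rewrite -addn1 natrD -mul2n natrM.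
(* [X] = m/2 lies between n/6 and m - 2a, so all powers are compared over this one base. *)
rewrite eN; set X : R := m%:R / 2; set p : R := (2 * m%:R + 1) / 12%:R.
have X24 : 2 ^+ 24 <= X by rewrite /X ler_pdivlMr // -exprSr.
have X16 : 16 <= X by rewrite /X; lra.
have le_base : powR ((2 * m%:R + 1) / 6%:R) p <= powR X p.
  by apply: ge0_ler_powR; rewrite ?nnegrE /p /X; lra.
apply: le_trans le_base _.
(* The threshold 2^25 for m makes [X] at least 2^24, and 2^m is 2^24 to the power m/24. *)
have two_pow : 2 ^+ m <= powR X (m%:R / 24).
  have -> : 2 ^+ m = powR (powR 2 24%:R) (m%:R / 24) :> R.
    by rewrite -powRrM mulrC divfK ?powR_mulrn // pnatr_eq0.
  apply: ge0_ler_powR; rewrite ?nnegrE ?powR_ge0 //; try lra.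
  by rewrite powR_mulrn.
have aR : m%:R <= 4 * a%:R + 3 :> R.
  by rewrite -(natrM _ 4) -natrD ler_nat /a; lia.
have hX : X <= (m - a.*2)%:R.
  rewrite /X ler_pdivrMr // -natrM ler_nat /a; lia.
rewrite -(@ler_pM2r _ (2 ^+ m)) ?exprn_gt0 //.
apply: (@le_trans _ _ (powR X p * powR X (m%:R / 24))).
  by rewrite ler_wpM2l ?powR_ge0.
rewrite -powRD; last by apply/implyP => _; rewrite gt_eqF; lra.
(* The exponents fit: p + m/24 = 5m/24 + 1/12 is at most (m - 3)/4, hence at most a, once m is at
   least 20. *)
apply: (@le_trans _ _ (powR X a%:R)).
  by apply: ler_powR; rewrite /p; lra.
rewrite powR_mulrn; last lra.
apply: (@le_trans _ _ ((m - a.*2)%:R ^+ a)).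
  by apply: lerXn2r; rewrite ?nnegrE //; lra.
by rewrite -!natrX -natrM ler_nat.
Qed.

Theorem theorem3p4 (R : realType) :
  exists2 C : R, 0 < C &
    exists N : nat, forall (V : finType) (D : {set {set V}}),
      (N <= #|V|)%N -> steiner_triple_system D ->
      C * powR (#|V|%:R / 6%:R) (#|V|%:R / 12%:R) <= #|spanning_trees D|%:R.
Proof.
exists 1; first exact: ltr01.
(* Since n = 2m + 1, a bound of 2^26 on n forces m to be at least 2^25. *)
exists (2 ^ 26)%N => V D large stsD; rewrite mul1r.
have /card_gt0P[r _] : (0 < #|V|)%N by apply: leq_trans large; rewrite expn_gt0.
move: large; rewrite (sts_card_vertices stsD r) expnS => large.
have le_deg : (2 ^ 25 <= degree D r)%N by move: large; move: (2 ^ 25)%N => c; lia.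
have deg_gt0 : (0 < degree D r)%N by apply: leq_trans le_deg; rewrite expn_gt0.
apply: powR_le_of_expn_le; first by rewrite -natrX ler_nat.
by apply: spanning_trees_lb; rewrite ?leq_div.
Qed.
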